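(* Let $L_1:=L_1(1,\infty)$ and let $A$ be the bounded operator on $L_1$ given by $(Au)(s)=u(s)/s$. Let $g$ be a Stieltjes function with representation $(0,0,\mu)$ and $g(0+)=\infty$. The condition $$\int_1^\infty\frac{|g'(1/t)|\,\|C_t(A)u\|_{L_1}}{t^2}\,dt<\infty$$ holds for all $u\in\mathrm{dom}(g(A))$ if and only if $g$ is integrable on $(0,1)$ and there exists $c>0$ such that $$\frac1t\int_0^t g(\tau)\,d\tau\le c\,g(t),\qquad t\in(0,1).$$
   Context: A Stieltjes function with representation $(0,0,\mu)$ is a function $g(z)=\int_{(0,\infty)}\frac{\mu(ds)}{z+s}$, $z>0$, where $\mu$ is a positive Radon measure on $(0,\infty)$ with $\int_{(0,\infty)}\frac{\mu(ds)}{1+s}<\infty$. Here $g(0+)=\lim_{s\to0+}g(s)$. The operator $-A$ generates the contraction $C_0$-semigroup $(T(t)u)(s)=e^{-t/s}u(s)$ on $L_1$, and $C_t(A)u:=\frac1t\int_0^tT(\tau)u\,d\tau$, i.e. $(C_t(A)u)(s)=\frac{s(1-e^{-t/s})}{t}u(s)$, for $t>0$. The operator $g(A)$ (defined by the extended Hille–Phillips functional calculus) is the multiplication operator $(g(A)u)(s)=g(1/s)u(s)$ with domain $\mathrm{dom}(g(A))=\{u\in L_1:\int_1^\infty g(1/s)|u(s)|\,ds<\infty\}$. *)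

(* Defs.v *)
From HB Require Import structures.
From mathcomp Require Import all_boot all_order all_algebra.
From mathcomp Require Import all_classical all_reals all_analysis.
From mathcomp Require Import measurable_realfun ring lra.

Set Implicit Arguments.
Unset Strict Implicit.
Unset Printing Implicit Defensive.

Import Order.TTheory GRing.Theory Num.Theory.
Import numFieldNormedType.Exports.

Local Open Scope classical_set_scope.
Local Open Scope ring_scope.

(* A measure on (0,oo) is given by a Borel measure on the line; only its values
   on subsets of (0,oo) are ever used.  Since (0,oo) is locally compact and
   second countable, a Borel measure there is Radon (inner regularity
   included) as soon as it is finite on compact sets. *)
Definition radon_on_pos (R : realType)
    (mu : {measure set (measurableTypeR R) -> \bar R}) : Prop :=
  forall K : set R, compact K -> K `<=` `]0, +oo[ -> (mu K < +oo)%E.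

(* g is the Stieltjes function with representation (0, 0, mu); the values of g
   outside (0,oo) are irrelevant. *)
Definition stieltjes_repr (R : realType)
    (mu : {measure set (measurableTypeR R) -> \bar R}) (g : R -> R) : Prop :=
  [/\ radon_on_pos mu,
      (\int[mu]_(s in `]0%R, +oo[) ((1 + s)^-1)%:E < +oo)%E
    & forall z : R, 0 < z ->
        (g z)%:E = (\int[mu]_(s in `]0%R, +oo[) ((z + s)^-1)%:E)%E].

(* The elements of L_1(1,oo) are represented by real functions on the line, of
   which only the restriction to (1,oo) matters. *)
Definition inL1 (R : realType) (u : R -> R) : Prop :=
  (@lebesgue_measure R).-integrable `]1%R, +oo[ (EFin \o u).

Definition L1norm (R : realType) (u : R -> R) : \bar R :=
  (\int[@lebesgue_measure R]_(s in `]1%R, +oo[) (`|u s|)%:E)%E.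

Definition opA (R : realType) (u : R -> R) : R -> R := fun s => u s / s.

Definition semigroupT (R : realType) (t : R) (u : R -> R) : R -> R :=
  fun s => expR (- (t / s)) * u s.

(* The integral of T(tau)u over [0, t] is taken pointwise in s; this is a
   representative of the L_1-valued integral. *)
Definition cesaro_mean (R : realType) (t : R) (u : R -> R) : R -> R :=
  fun s => t^-1 *
    (\int[@lebesgue_measure R]_(tau in `[0%R, t]) (semigroupT tau u s))%R.

(* The domain of the operator g(A), which acts by (g(A)u)(s) = g(1/s) u(s). *)
Definition dom_gA (R : realType) (g : R -> R) : set (R -> R) :=
  [set u | inL1 u /\
    (\int[@lebesgue_measure R]_(s in `]1%R, +oo[) (g s^-1 * `|u s|)%:E
       < +oo)%E].

Lemma cesaro_meanE (R : realType) (t : R) (u : R -> R) (s : R) :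
  0 < t -> 0 < s -> cesaro_mean t u s = s * (1 - expR (- (t / s))) / t * u s.
Proof.
move=> t0 s0; rewrite /cesaro_mean /semigroupT.
pose f (x : R) := expR (- (x / s)) * u s.
pose F (x : R) := - (s * expR (- (x / s)) * u s).
have dF (x : R) : is_derive x (1 : R) F (f x).
  rewrite /F /f; apply: is_derive_eq.
  rewrite /GRing.scale /=; field; exact: lt0r_neq0.
have cf : continuous f.
  by move=> x; apply: differentiable_continuous; apply/derivable1_diffP.
have cF : continuous F.
  by move=> x; apply: differentiable_continuous; apply/derivable1_diffP.
have -> : (\int[@lebesgue_measure R]_(tau in `[0%R, t]) f tau)%R = F t - F 0.
  rewrite /Rintegral (@continuous_FTC2 _ f F) //.
  - exact: continuous_subspaceT.
  - split; [by move=> x _; case: (dF x)| |].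
      exact/cvg_at_right_filter/cF.
    exact/cvg_at_left_filter/cF.
  - by move=> x _; rewrite derive1E; case: (dF x).
rewrite /F mul0r oppr0 expR0; field.
by rewrite lt0r_neq0.
Qed.

Lemma opA_norm (R : realType) (u : R -> R) : inL1 u ->
  inL1 (opA u) /\ (L1norm (opA u) <= L1norm u)%E.
Proof.
move=> iu.
have mI : measurable_fun (`]1%R, +oo[ : set R) (GRing.inv : R -> R).
  apply: open_continuous_measurable_fun; first exact: interval_open.
  move=> x; rewrite inE/= in_itv/= andbT => x1.
  by apply: inv_continuous; rewrite gt_eqF// (lt_trans _ x1).
have mu_ : measurable_fun (`]1%R, +oo[ : set R) u.
  by apply/measurable_EFinP; exact: (measurable_int _ iu).
have mA : measurable_fun (`]1%R, +oo[ : set R) (opA u).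
  exact: measurable_funM.
have le1 (x : R) : `]1%R, +oo[%classic x -> `|opA u x| <= `|u x|.
  rewrite /= in_itv/= andbT => x1; rewrite normrM ler_piMr// normfV.
  by rewrite invf_le1 ?gtr0_norm ?(ltW x1) ?(lt_trans _ x1).
split.
  by apply: (le_integrable _ _ _ iu) => //; exact/measurable_EFinP.
by apply: ge0_le_integral => //; apply/measurable_EFinP;
  exact: measurableT_comp.
Qed.

(* The generator of T is -opA: the difference quotients of T converge to
   -opA u in L_1 for every u. *)
Lemma generatorT (R : realType) (u : R -> R) : inL1 u ->
  L1norm (fun s => h^-1 * (semigroupT h u s - u s) + opA u s)
    @[h --> 0^'+] --> 0%E.
Proof.
move=> iu.
have mI : measurable_fun (`]1%R, +oo[ : set R) (GRing.inv : R -> R).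
  apply: open_continuous_measurable_fun; first exact: interval_open.
  move=> x; rewrite inE/= in_itv/= andbT => x1.
  by apply: inv_continuous; rewrite gt_eqF// (lt_trans _ x1).
have mu_ : measurable_fun (`]1%R, +oo[ : set R) u.
  by apply/measurable_EFinP; exact: (measurable_int _ iu).
have finu : L1norm u \is a fin_num.
  rewrite ge0_fin_numE; last by apply: integral_ge0.
  by move/integrableP : iu => [].
have qle (h s : R) : 0 < h -> 1 < s ->
    `|h^-1 * (semigroupT h u s - u s) + opA u s| <= h * `|u s|.
  move=> h0 s1; have s0 : 0 < s by exact: lt_trans s1.
  rewrite /semigroupT /opA.
  set a := s^-1; set e := expR _.
  have a0 : 0 < a by rewrite invr_gt0.
  have a1 : a <= 1 by rewrite invf_le1// ltW.
  have -> : h^-1 * (e * u s - u s) + u s * a =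
      h^-1 * (e - 1 + h * a) * u s by field; rewrite lt0r_neq0.
  rewrite normrM ler_wpM2r//.
  have e1 : 1 - h * a <= e by have := expR_ge1Dx (- (h * a)); rewrite /e.
  have e2 : e * (1 + h * a) <= 1.
    rewrite -[leRHS](@expRxMexpNx_1 R (h * a)) mulrC ler_wpM2r ?expR_ge0//.
    exact: expR_ge1Dx.
  have e0 : 0 < e by exact: expR_gt0.
  have ha : 0 < h * a by exact: mulr_gt0.
  rewrite normrM gtr0_norm ?invr_gt0// ger0_norm; last lra.
  rewrite ler_pdivrMl//.
  have e3 : e - 1 + h * a <= (h * a) * (h * a) by nra.
  apply: le_trans e3 _.
  by rewrite ler_pM ?(ltW ha)// ler_piMr// ltW.
apply: (@squeeze_cvge _ _ _ _ (cst 0%E) _ (fun h : R => h%:E * L1norm u)%E).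
- near=> h; apply/andP; split; first exact: integral_ge0.
  have h0 : 0 < h by near: h; exact: nbhs_right_gt.
  rewrite /L1norm -ge0_integralZl//; last 2 first.
    by apply/measurable_EFinP; exact: measurableT_comp.
    by rewrite lee_fin ltW.
  apply: ge0_le_integral => //.
  + apply/measurable_EFinP; apply: measurableT_comp => //.
    apply: measurable_funD; last exact: measurable_funM.
    apply: measurable_funM => //; apply: measurable_funB => //.
    apply: measurable_funM => //; apply: measurableT_comp => //.
    by apply: measurableT_comp => //; exact: measurable_funM.
  + apply: measurable_funeM.
    by apply/measurable_EFinP; exact: measurableT_comp.
  + move=> s; rewrite /= in_itv/= andbT => s1.
    by rewrite -EFinM lee_fin; exact: qle.
- exact: cvg_cst.
- rewrite -(fineK finu) -[X in _ --> X](mul0e (fine (L1norm u))%:E) -EFinM.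
  apply: cvg_EFin; first by near=> h.
  apply: cvgM; last exact: cvg_cst.
  by apply: cvg_at_right_filter; exact: cvg_id.
Unshelve. all: by end_near.
Qed.

(* Main.v *)
Require Import Defs.
From mathcomp Require Import all_boot all_order all_algebra.
From mathcomp Require Import all_classical all_reals all_analysis.
From mathcomp Require Import measurable_realfun ring lra.
Import Order.TTheory GRing.Theory Num.Theory.
Import numFieldNormedType.Exports.
Local Open Scope classical_set_scope.
Local Open Scope ring_scope.

(** By Tonelli the condition for [u] says that [u] is integrable against
    [s |-> int_1^oo |g'(1/t)| t^-2 (s/t) (1 - e^(-t/s)) dt].  Since
    [(1 - e^-y) / y] is comparable to [min(1, 1/y)], this weight is comparable
    to [N s := int_1^oo (d/dt g(1/t)) min(1, s/t) dt], and writing [min(1, s/t)]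
    as [s |{x < 1/s : x < 1/t}|] gives, with [sigma = 1/s],
    [N s = (1/sigma) int_0^sigma (g - g 1)].  So the condition on all of
    [dom (g(A))] asks that the weighted space [L_1(g(1/s) ds)] embed into
    [L_1(N(s) ds)].  As both weights are monotone and [g(1/s)] is doubling, this
    means [N s <= C g(1/s)] for all [s > 1], which is the mean condition on
    [g]. *)

Set Implicit Arguments.
Unset Strict Implicit.

(** * Preliminaries on integrability and continuity *)

Lemma integrable_scale d (T : measurableType d) (R : realType)
    (m : {measure set T -> \bar R}) (D : set T) (c : R) (f : T -> R) :
  measurable D -> m.-integrable D (EFin \o f) ->
  m.-integrable D (fun x => (c * f x)%:E).
Proof.
move=> mD fi; rewrite (_ : (fun x => _) = (fun x => c%:E * (EFin \o f) x)%E).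
  exact: integrableZl.
by apply/funext => x; rewrite EFinM.
Qed.

Lemma near_lipschitz_continuous (R : realType) (f : R -> R) (x C : R) :
  (\forall z \near x, `|f z - f x| <= C * `|z - x|) -> {for x, continuous f}.
Proof.
move=> fC; apply/cvgrPdist_le => e e0; near=> z.
(* The constant [C] may be zero or negative; [|C| + 1] is a positive majorant by which [e] can be
   divided. *)
rewrite distrC; apply: (le_trans (_ : _ <= (`|C| + 1) * `|z - x|)).
  apply: (le_trans (_ : _ <= C * `|z - x|)); first by near: z.
  by rewrite ler_wpM2r// (le_trans (ler_norm C))// lerDl.
have C0 : 0 < `|C| + 1 by rewrite ltr_wpDl.
rewrite -ler_pdivlMl// distrC; near: z.
by apply: cvgr_dist_le; [exact: cvg_id|rewrite mulr_gt0// invr_gt0].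
Unshelve. all: by end_near. Qed.

(** * Monotonicity, dilation and differentiability of Stieltjes functions *)

Section stieltjes.
Context {R : realType} (mu : {measure set (measurableTypeR R) -> \bar R}).
Variable g : R -> R.
Hypothesis hg : stieltjes_repr mu g.

Local Notation P := (`]0%R, +oo[%classic : set R).

Lemma measurable_resolvent (z : R) : 0 < z ->
  measurable_fun (P : set (measurableTypeR R)) (fun s : R => (z + s)^-1).
Proof.
move=> z0; apply: open_continuous_measurable_fun; first exact: interval_open.
move=> x; rewrite inE/= in_itv/= andbT => x0.
apply: continuous_comp; last first.
  by apply: inv_continuous; rewrite gt_eqF// addr_gt0.
by apply: cvgD; [exact: cvg_cst|exact: cvg_id].
Qed.

Lemma integrable_resolvent (z : R) : 0 < z ->
  mu.-integrable (P : set (measurableTypeR R)) (fun s : R => ((z + s)^-1)%:E).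
Proof.
move=> z0; apply/integrableP; split.
  by apply/measurable_EFinP; exact: measurable_resolvent.
rewrite (_ : integral _ _ _ = (g z)%:E) ?ltry//.
case: hg => _ _ -> //; apply: eq_integral.
move=> s; rewrite inE/= in_itv/= andbT => s0.
by rewrite ger0_norm// invr_ge0 addr_ge0// ltW.
Qed.

Lemma stieltjesE (z : R) : 0 < z ->
  g z = (\int[mu]_(s in (P : set (measurableTypeR R))) (z + s)^-1)%R.
Proof. by move=> z0; case: hg => _ _ /(_ z z0); rewrite /Rintegral => <-. Qed.

Lemma stieltjes_ge0 (z : R) : 0 < z -> 0 <= g z.
Proof.
move=> z0; rewrite stieltjesE//; apply: Rintegral_ge0 => s.
by rewrite /= in_itv/= andbT => s0; rewrite invr_ge0 addr_ge0 ?ltW.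
Qed.

Lemma le_stieltjes (x y : R) : 0 < x -> x <= y -> g y <= g x.
Proof.
move=> x0 xy; have y0 : 0 < y by exact: lt_le_trans xy.
rewrite !stieltjesE//; apply: le_Rintegral => //;
  [exact: integrable_resolvent|exact: integrable_resolvent|move=> s].
rewrite /= in_itv/= andbT => s0.
by rewrite lef_pV2 ?lerD2r// posrE addr_gt0.
Qed.

(** For [c <= 1] one has [c z + s >= c (z + s)] under the integral. The case [c = 1/2] is the
    doubling property of [g(1/s)]. *)
Lemma stieltjes_dilation (c z : R) : 0 < c <= 1 -> 0 < z -> g (c * z) <= c^-1 * g z.
Proof.
move=> /andP[c0 c1] z0; have cz0 : 0 < c * z by exact: mulr_gt0.
rewrite !stieltjesE// -RintegralZl//; last exact: integrable_resolvent.
apply: le_Rintegral => //; first exact: integrable_resolvent.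
  apply: integrable_scale => //.
  exact: integrable_resolvent.
move=> s; rewrite /= in_itv/= andbT => s0.
rewrite -invfM lef_pV2 ?posrE ?addr_gt0 ?mulr_gt0 ?addr_gt0//.
by rewrite mulrDr lerD2l ger_pMl.
Qed.

(** This is [- g' x], obtained by formal differentiation under the integral sign. *)
Definition stieltjes_slope (x : R) : R :=
  (\int[mu]_(s in (P : set (measurableTypeR R))) ((x + s)^-1 ^+ 2))%R.

Lemma integrable_resolvent2 (x : R) : 0 < x ->
  mu.-integrable (P : set (measurableTypeR R)) (fun s : R => ((x + s)^-1 ^+ 2)%:E).
Proof.
move=> x0.
apply: (@le_integrable _ _ _ mu _ _ _ (fun s : R => (x^-1 * (x + s)^-1)%:E)) => //.
- apply/measurable_EFinP; apply: measurable_funX; exact: measurable_resolvent.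
- move=> s; rewrite /= in_itv/= andbT => s0; rewrite lee_fin.
  rewrite !ger0_norm ?exprn_ge0 ?mulr_ge0 ?invr_ge0 ?addr_ge0 ?ltW//.
  rewrite expr2 ltr_pM2r ?invr_gt0 ?addr_gt0//.
  by rewrite ltf_pV2 ?posrE ?addr_gt0// ltrDl.
- apply: integrable_scale => //; exact: integrable_resolvent.
Qed.

Lemma stieltjes_slope_ge0 (x : R) : 0 <= stieltjes_slope x.
Proof. by apply: Rintegral_ge0 => s _; exact: sqr_ge0. Qed.

(* Integrate [1/(y+s) - 1/(x+s) + (y-x)/(x+s)^2 = (y-x)^2/((x+s)^2 (y+s))]. *)
Lemma stieltjes_quadratic (x y : R) : 0 < x -> 0 < y ->
  0 <= g y - g x + (y - x) * stieltjes_slope x <= (y - x) ^+ 2 * (x^-1 ^+ 2 * g y).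
Proof.
move=> x0 y0; rewrite !stieltjesE// -RintegralB//; [|exact: integrable_resolvent..].
have ix := integrable_resolvent x0; have iy := integrable_resolvent y0.
have ix2 := integrable_resolvent2 x0.
have iB : mu.-integrable (P : set (measurableTypeR R))
    (fun s : R => ((y + s)^-1 - (x + s)^-1)%:E).
  by apply: (integrableB _ iy ix).
have idE (s : R) : 0 < s -> (y + s)^-1 - (x + s)^-1 + (y - x) * (x + s)^-1 ^+ 2 =
    (y - x) ^+ 2 * ((x + s)^-1 ^+ 2 * (y + s)^-1).
  by move=> s0; field; rewrite !gt_eqF ?addr_gt0.
rewrite /stieltjes_slope -RintegralZl// -RintegralD//; last exact: integrable_scale.
apply/andP; split.
  apply: Rintegral_ge0 => s; rewrite /= in_itv/= andbT => s0; rewrite idE//.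
  by rewrite mulr_ge0 ?sqr_ge0// mulr_ge0 ?sqr_ge0// invr_ge0 addr_ge0 ?ltW.
rewrite -RintegralZl// -RintegralZl//; last exact: integrable_scale.
apply: le_Rintegral => //.
- by apply: (integrableD _ iB (integrable_scale (y - x) _ ix2)).
- by apply: integrable_scale => //; exact: integrable_scale.
move=> s; rewrite /= in_itv/= andbT => s0; rewrite idE//.
rewrite ler_wpM2l ?sqr_ge0// ler_wpM2r ?invr_ge0 ?addr_ge0 ?ltW//.
rewrite ltr_pXn2r ?nnegrE ?invr_ge0 ?addr_ge0 ?ltW//.
by rewrite ltf_pV2 ?posrE ?addr_gt0// ltrDl.
Qed.

(** The quadratic remainder bound makes the difference quotient Lipschitz at [x], which is
    Caratheodory's criterion. Keeping [z > x / 2] bounds [g z] by [g (x / 2)], so the Lipschitz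
    constant does not depend on [z]. *)
Lemma is_derive_stieltjes (x : R) : 0 < x -> is_derive x 1 g (- stieltjes_slope x).
Proof.
move=> x0; apply/is_derive1_caratheodory.
exists (fun z => if z == x then - stieltjes_slope x else (g z - g x) / (z - x)).
split; last by rewrite eqxx.
  move=> z; case: eqVneq => [->|zx]; first by rewrite !subrr mulr0.
  by rewrite mulfVK// subr_eq0.
apply: (@near_lipschitz_continuous _ _ _ (x^-1 ^+ 2 * g (x / 2))).
near=> z; rewrite eqxx; have x20 : 0 < x / 2 by rewrite divr_gt0.
case: eqVneq => [->|zx]; first by rewrite !subrr normr0 mulr0.
have xz : x / 2 < z by near: z; apply: (cvgr_gt x) => //; lra.
have z0 : 0 < z by exact: lt_trans xz.
have zx0 : z - x != 0 by rewrite subr_eq0.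
have /andP[q0 q1] := stieltjes_quadratic x0 z0.
rewrite opprK [X in `|X|](_ : _ =
  (z - x)^-1 * (g z - g x + (z - x) * stieltjes_slope x)); last by field.
rewrite normrM normfV ler_pdivrMl ?normr_gt0// (ger0_norm q0) (le_trans q1)//.
rewrite [leRHS]mulrCA -normrM -expr2 ger0_norm ?sqr_ge0// [leRHS]mulrC.
by rewrite ler_wpM2l ?sqr_ge0// ler_wpM2l ?sqr_ge0// le_stieltjes// ltW.
Unshelve. all: by end_near. Qed.

(** Add the quadratic bound to the one with [x] and [z] exchanged: the values of [g] cancel, and
    [(z - x)] times the difference of slopes is at most [2 K (z - x)^2] in absolute value. *)
Lemma continuous_stieltjes_slope (x : R) : 0 < x ->
  {for x, continuous stieltjes_slope}.
Proof.
move=> x0; have x20 : 0 < x / 2 by rewrite divr_gt0.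
set K := (x / 2)^-1 ^+ 2 * g (x / 2).
apply: (@near_lipschitz_continuous _ _ _ (K + K)).
have boundK (a b : R) : x / 2 <= a -> x / 2 <= b -> a^-1 ^+ 2 * g b <= K.
  move=> xa xb; have a0 := lt_le_trans x20 xa; have b0 := lt_le_trans x20 xb.
  rewrite ler_pM ?sqr_ge0 ?stieltjes_ge0 ?le_stieltjes//.
  by rewrite ler_pXn2r ?nnegrE ?invr_ge0 ?(ltW a0) ?(ltW x20)// lef_pV2.
near=> z; have [->|zx] := eqVneq z x; first by rewrite !subrr normr0 mulr0.
have xz : x / 2 < z by near: z; apply: (cvgr_gt x) => //; lra.
have z0 : 0 < z by exact: lt_trans xz.
have /andP[p0 p1] := stieltjes_quadratic x0 z0.
have /andP[q0 q1] := stieltjes_quadratic z0 x0.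
have xx : x / 2 <= x by lra.
have {}p1 : g z - g x + (z - x) * stieltjes_slope x <= (z - x) ^+ 2 * K.
  by rewrite (le_trans p1)// ler_wpM2l ?sqr_ge0// boundK// ltW.
have {}q1 : g x - g z + (x - z) * stieltjes_slope z <= (z - x) ^+ 2 * K.
  by rewrite (le_trans q1)// -(sqrrN (x - z)) opprB ler_wpM2l ?sqr_ge0//
    boundK// ltW.
have zx0 : 0 < `|z - x| by rewrite normr_gt0 subr_eq0.
rewrite -(ler_pM2r zx0) -normrM -mulrA -normrM -expr2 (ger0_norm (sqr_ge0 _)).
rewrite ler_norml; apply/andP; split; lra.
Unshelve. all: by end_near. Qed.

Lemma derive1_stieltjes (x : R) : 0 < x -> derive1 g x = - stieltjes_slope x.
Proof. by move=> x0; rewrite derive1E; case: (is_derive_stieltjes x0). Qed.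

Lemma continuous_stieltjes (x : R) : 0 < x -> {for x, continuous g}.
Proof.
move=> x0; apply: differentiable_continuous; apply/derivable1_diffP.
by case: (is_derive_stieltjes x0).
Qed.

End stieltjes.

(** * Tonelli's theorem and measurability on rectangles *)

Section tonelli_setX.
Local Open Scope ereal_scope.
Context d1 d2 (T1 : measurableType d1) (T2 : measurableType d2) (R : realType).
Variables (m1 : {sigma_finite_measure set T1 -> \bar R})
  (m2 : {sigma_finite_measure set T2 -> \bar R}).
Variables (D1 : set T1) (D2 : set T2) (f : T1 * T2 -> \bar R).
Hypotheses (mD1 : measurable D1) (mD2 : measurable D2).
Hypothesis mf : measurable_fun (D1 `*` D2) f.
Hypothesis f0 : forall x y, D1 x -> D2 y -> 0 <= f (x, y).

(** Extension by zero reduces the rectangle to the whole product, so measurability and sign of [f]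
    are asked on [D1 x D2] only. *)
Let F := f \_ (D1 `*` D2).

Let mF : measurable_fun setT F.
Proof. by apply/(measurable_restrictT _ _).1 => //; exact: measurableX. Qed.

Let F0 z : 0 <= F z.
Proof.
rewrite /F patchE; case: ifPn => //; rewrite inE => -[].
by case: z => x y /=; exact: f0.
Qed.

Let FE1 : (fun x => \int[m2]_y F (x, y)) =
  (fun x => \int[m2]_(y in D2) f (x, y)) \_ D1.
Proof.
apply/funext => x; rewrite patchE; case: ifPn => xD1.
  rewrite [RHS]integral_mkcond; apply: eq_integral => y _.
  by rewrite /F !patchE in_setX xD1.
by rewrite integral0_eq// => y _; rewrite /F patchE in_setX (negbTE xD1).
Qed.

Let FE2 : (fun y => \int[m1]_x F (x, y)) =
  (fun y => \int[m1]_(x in D1) f (x, y)) \_ D2.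
Proof.
apply/funext => y; rewrite patchE; case: ifPn => yD2.
  rewrite [RHS]integral_mkcond; apply: eq_integral => x _.
  by rewrite /F !patchE in_setX yD2 andbT.
by rewrite integral0_eq// => x _; rewrite /F patchE in_setX (negbTE yD2) andbF.
Qed.

Lemma integral_setX12 : \int[m1 \x m2]_(z in D1 `*` D2) f z =
  \int[m1]_(x in D1) \int[m2]_(y in D2) f (x, y).
Proof.
rewrite integral_mkcond fubini_tonelli1// [RHS]integral_mkcond.
by rewrite /fubini_F FE1.
Qed.

Lemma integral_setX21 : \int[m1 \x m2]_(z in D1 `*` D2) f z =
  \int[m2]_(y in D2) \int[m1]_(x in D1) f (x, y).
Proof.
rewrite integral_mkcond fubini_tonelli2// [RHS]integral_mkcond.
by rewrite /fubini_G FE2.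
Qed.

Lemma measurable_fun_integral_setX1 :
  measurable_fun D1 (fun x => \int[m2]_(y in D2) f (x, y)).
Proof.
apply/(measurable_restrictT _ mD1).2; rewrite -FE1.
exact: (@measurable_fun_fubini_tonelli_F _ _ _ _ _ m2 F).
Qed.

Lemma measurable_fun_integral_setX2 :
  measurable_fun D2 (fun y => \int[m1]_(x in D1) f (x, y)).
Proof.
apply/(measurable_restrictT _ mD2).2; rewrite -FE2.
exact: (@measurable_fun_fubini_tonelli_G _ _ _ _ _ m1 F).
Qed.

End tonelli_setX.

Section setX_coordinates.
Context d1 d2 (T1 : measurableType d1) (T2 : measurableType d2) (R : realType).
Variables (D1 : set T1) (D2 : set T2).
Hypotheses (mD1 : measurable D1) (mD2 : measurable D2).

Lemma measurable_fun_setX_fst (f : T1 -> R) : measurable_fun D1 f ->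
  measurable_fun (D1 `*` D2) (fun z => f z.1).
Proof.
move=> mf; apply: (@measurable_comp _ _ _ _ _ _ D1 _ _ fst) => //.
  by move=> _ [z [zD _] <-].
by apply: measurable_funS measurable_fst.
Qed.

Lemma measurable_fun_setX_snd (f : T2 -> R) : measurable_fun D2 f ->
  measurable_fun (D1 `*` D2) (fun z => f z.2).
Proof.
move=> mf; apply: (@measurable_comp _ _ _ _ _ _ D2 _ _ snd) => //.
  by move=> _ [z [_ zD] <-].
by apply: measurable_funS measurable_snd.
Qed.

End setX_coordinates.

Lemma measurable_fun_lt_indicator d (T : measurableType d) (R : realType)
    (D : set T) (f1 f2 : T -> R) :
  measurable_fun D f1 -> measurable_fun D f2 ->
  measurable_fun D (fun x => (f1 x < f2 x)%R%:R : R).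
Proof.
move=> mf1 mf2 mD.
rewrite (_ : (fun _ => _) = fun x => if f1 x < f2 x then 1 else 0 : R).
  by apply: measurable_fun_if => //; exact: measurable_fun_ltr.
by apply/funext => x; case: ifP.
Qed.

Lemma measurable_inv_gt1 (R : realType) :
  measurable_fun (`]1%R, +oo[ : set R) (GRing.inv : R -> R).
Proof.
apply: open_continuous_measurable_fun; first exact: interval_open.
move=> x; rewrite inE/= in_itv/= andbT => x1.
by apply: inv_continuous; rewrite gt_eqF// (lt_trans _ x1).
Qed.

(** * The weight attached to the condition, and its formula as a mean *)

Section kernel.
Context {R : realType} (mu : {measure set (measurableTypeR R) -> \bar R}).
Variable g : R -> R.
Hypothesis hg : stieltjes_repr mu g.

Local Notation leb := (@lebesgue_measure R).
Local Notation h := (stieltjes_slope mu).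

(** For [t > 0] this is the derivative of [g(1/t)] in [t], that is, the factor [|g'(1/t)| / t^2] of
    the condition. *)
Definition inv_density (t : R) : R := h t^-1 * t^-1 ^+ 2.

Local Notation k := inv_density.

Lemma inv_density_ge0 (t : R) : 0 <= k t.
Proof. by rewrite mulr_ge0 ?sqr_ge0// stieltjes_slope_ge0. Qed.

Lemma continuous_inv_density (t : R) : 0 < t -> {for t, continuous k}.
Proof.
move=> t0; have ci : {for t, continuous (GRing.inv : R -> R)}.
  by apply: inv_continuous; rewrite gt_eqF.
apply: continuousM; last by apply: continuousM.
apply: continuous_comp => //.
by apply: (continuous_stieltjes_slope hg); rewrite invr_gt0.
Qed.

Lemma measurable_inv_density : measurable_fun (`]1%R, +oo[ : set R) k.
Proof.
apply: open_continuous_measurable_fun; first exact: interval_open.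
move=> x; rewrite inE/= in_itv/= andbT => x1.
by apply: continuous_inv_density; rewrite (lt_trans _ x1).
Qed.

Lemma is_derive_stieltjes_inv (t : R) : 0 < t ->
  is_derive t 1 (fun x : R => g x^-1) (k t).
Proof.
move=> t0; have t'0 : 0 < t^-1 by rewrite invr_gt0.
have gd := is_derive_stieltjes hg t'0.
have t0' : t != 0 by rewrite gt_eqF.
have dv : is_derive t 1 (fun x : R => x^-1) (- (t^-1 ^+ 2)).
  have := @is_deriveV R id t 1 1 t0' (is_derive_id _ _).
  by rewrite /GRing.scale/= mulr1 exprVn.
have := @is_derive1_comp R g (fun x => x^-1) t _ _ gd dv.
by rewrite mulrNN.
Qed.

Lemma integral_inv_density (b : R) : 1 < b ->
  (\int[leb]_(t in `]1%R, b[) (k t)%:E = (g b^-1 - g 1)%:E)%E.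
Proof.
move=> b1; have gt0 (t : R) : 1 <= t -> 0 < t by exact: lt_le_trans.
have cg (t : R) : 1 <= t -> {for t, continuous (fun x : R => g x^-1)}.
  move=> t1; apply: differentiable_continuous; apply/derivable1_diffP.
  by case: (is_derive_stieltjes_inv (gt0 t t1)).
(* The flags [true false] close both endpoints: the fundamental theorem is applied on [[1, b]]. *)
rewrite -(@integral_itv_bndoo _ _ _ _ true false); last first.
  apply/measurable_EFinP; apply: measurable_funS measurable_inv_density => //.
  by move=> t; rewrite /= !in_itv/= => /andP[->].
rewrite (@continuous_FTC2 _ k (fun x : R => g x^-1))//.
- by rewrite invr1 EFinB.
- apply: continuous_in_subspaceT => t; rewrite inE/= in_itv/= => /andP[t1 _].
  exact/continuous_inv_density/gt0.
- split.
  + move=> t; rewrite in_itv/= => /andP[/ltW/gt0 t0 _].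
    by case: (is_derive_stieltjes_inv t0).
  + exact/cvg_at_right_filter/cg.
  + exact/cvg_at_left_filter/cg/ltW.
- move=> t; rewrite in_itv/= => /andP[/ltW/gt0 t0 _].
  by rewrite derive1E; case: (is_derive_stieltjes_inv t0).
Qed.

Lemma integral_lt_indicator (a b : R) : 0 < a -> 0 < b ->
  (\int[leb]_(x in `]0%R, a[) ((x < b)%R%:R)%:E = (Num.min a b)%:E)%E.
Proof.
move=> a0 b0.
transitivity (\int[leb]_(x in `]0%R, a[) (\1_(`]-oo, b[%classic : set R) x)%:E)%E.
  by apply: eq_integral => x _; rewrite indicE mem_setE in_itv.
rewrite integral_indic// setIC.
rewrite (_ : _ `&` _ = (`]0%R, Num.min a b[%classic : set R)); last first.
  apply/seteqP; split => x /=; rewrite !in_itv/= lt_min.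
    by move=> [/andP[-> ->] ->].
  by move=> /and3P[-> -> ->].
apply: etrans (lebesgue_measure_itv _) _; rewrite /= lte_fin lt_min a0 b0/=.
by rewrite oppr0 adde0.
Qed.

(** This is the weight [N]. It is extended-real because, for [s >= 1], it is infinite when [g] is
    not integrable near 0. *)
Definition cesaro_weight (s : R) : \bar R :=
  (\int[leb]_(t in `]1%R, +oo[) (k t * Num.min 1 (s / t))%:E)%E.

(* Tonelli applied to [min(1, s/t) = s |{x < 1/s : x < 1/t}|]; the inner
   integral in [t] is then [g x - g 1] by the fundamental theorem. *)
Lemma cesaro_weightE (s : R) : 1 <= s ->
  (cesaro_weight s = s%:E * \int[leb]_(x in `]0%R, s^-1%R[) (g x - g 1)%:E)%E.
Proof.
move=> s1; have s0 : 0 < s by exact: lt_le_trans s1.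
pose f (z : R * R) : \bar R := (k z.1 * (z.2 < z.1^-1)%R%:R)%:E.
have mf : measurable_fun ((`]1%R, +oo[ : set R) `*` (`]0%R, s^-1[ : set R)) f.
  apply/measurable_EFinP; apply: measurable_funM.
    by apply: measurable_fun_setX_fst => //; exact: measurable_inv_density.
  apply: measurable_fun_lt_indicator.
    by apply: measurable_funS measurable_snd.
  by apply: measurable_fun_setX_fst => //; exact: measurable_inv_gt1.
have f0 x y : 0 <= k x * (y < x^-1)%R%:R.
  by rewrite mulr_ge0 ?inv_density_ge0.
transitivity (\int[leb]_(t in `]1%R, +oo[)
    (s%:E * \int[leb]_(x in `]0%R, s^-1%R[) f (t, x)))%E.
  apply: eq_integral => t; rewrite inE/= in_itv/= andbT => t1.
  have t0 : 0 < t by exact: lt_trans t1.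
  under eq_integral do rewrite /f/= EFinM.
  rewrite ge0_integralZl_EFin//; last 2 first.
    apply/measurable_EFinP; apply: measurable_fun_lt_indicator => //.
    exact: inv_density_ge0.
  rewrite integral_lt_indicator ?invr_gt0// -!EFinM; congr (_%:E).
  by rewrite [RHS]mulrCA (minr_pMr _ _ (ltW s0)) divff ?gt_eqF.
rewrite ge0_integralZl_EFin//; last first.
- exact: ltW.
- apply: (measurable_fun_integral_setX1 leb _ _ mf) => // x y _ _.
  by rewrite lee_fin f0.
- by move=> t _; apply: integral_ge0 => x _; rewrite lee_fin f0.
congr (_ * _)%E.
rewrite -integral_setX12//; last by move=> x y _ _; rewrite lee_fin f0.
rewrite integral_setX21//; last by move=> x y _ _; rewrite lee_fin f0.
apply: eq_integral => x; rewrite inE/= in_itv/= => /andP[x0 xs].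
(* Since [1 <= s < 1/x], the fundamental theorem applies on []1, 1/x[], to which the indicator of
   [x < 1/t] truncates the range of [t]. *)
have sx : s < x^-1 by rewrite -(invrK s) ltf_pV2 ?posrE ?invr_gt0.
rewrite -(invrK x) -integral_inv_density ?(le_lt_trans s1)// invrK.
rewrite [LHS](_ : _ = (\int[leb]_(t in `]1%R, +oo[)
    ((fun t => (k t)%:E) \_ `]-oo, x^-1%R[) t)%E).
  rewrite -integral_mkcondr; congr integral.
  apply/seteqP; split => t /=; rewrite !in_itv/= andbT.
    by move=> [-> ->].
  by move=> /andP[-> ->].
apply: eq_integral => t; rewrite inE/= in_itv/= andbT => t1.
have t0 : 0 < t by exact: lt_trans t1.
rewrite patchE mem_setE in_itv/= /f/= -[x in (x < _)%R]invrK.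
rewrite ltf_pV2 ?posrE ?invr_gt0//.
by case: ifP; rewrite ?mulr1 ?mulr0.
Qed.
End kernel.

(** * The multiplier of the Cesaro mean *)

Definition cesaro_kernel (R : realType) (s t : R) : R :=
  s * (1 - expR (- (t / s))) / t.

Lemma cesaro_kernel_ge0 (R : realType) (s t : R) : 0 < s -> 0 < t ->
  0 <= cesaro_kernel s t.
Proof.
move=> s0 t0; rewrite mulr_ge0 ?invr_ge0 ?(ltW t0)// mulr_ge0 ?(ltW s0)// subr_ge0.
by rewrite -expR0 ler_expR oppr_le0 divr_ge0 ?ltW.
Qed.

(** With [y = t / s] the kernel is [(1 - e^-y) / y]. The upper bounds come from [e^-y >= 1 - y] and
    [e^-y > 0]. From [e^-y <= 1 / (1 + y)] the kernel is at least [1 / (1 + y)], which is at least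
    half of [min(1, 1/y)]; hence the factor 2. *)
Lemma cesaro_kernel_bounds (R : realType) (s t : R) : 0 < s -> 0 < t ->
  cesaro_kernel s t <= Num.min 1 (s / t) <= 2 * cesaro_kernel s t.
Proof.
move=> s0 t0; rewrite /cesaro_kernel; set y := t / s; set e := expR (- y).
have y0 : 0 < y by rewrite divr_gt0.
have e0 : 0 < e by exact: expR_gt0.
have e1 : 1 - y <= e by have := expR_ge1Dx (- y).
have e2 : e * (1 + y) <= 1.
  rewrite -[leRHS](@expRxMexpNx_1 R y) mulrC ler_wpM2r ?expR_ge0//.
  exact: expR_ge1Dx.
have -> : s * (1 - e) / t = (1 - e) / y by rewrite /y; field; rewrite !gt_eqF.
have -> : s / t = y^-1 by rewrite /y invf_div.
apply/andP; split.
  rewrite le_min ler_pdivrMr// mul1r; apply/andP; split; first lra.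
  rewrite ler_piMl ?invr_ge0 ?(ltW y0)//; lra.
rewrite ge_min; have [y1|y1] := leP y 1.
  by rewrite mulrA ler_pdivlMr// mul1r; apply/orP; left; nra.
apply/orP; right; rewrite mulrA ler_peMl ?invr_ge0 ?ltW//; nra.
Qed.

(** * Comparison of the condition with a weighted norm of [u] *)

Section cesaro_condition.
Context {R : realType} (mu : {measure set (measurableTypeR R) -> \bar R}).
Variable g : R -> R.
Hypothesis hg : stieltjes_repr mu g.

Local Notation leb := (@lebesgue_measure R).
Local Notation D := (`]1%R, +oo[%classic : set R).
Local Notation k := (inv_density mu).

Variable u : R -> R.
Hypothesis mu_ : measurable_fun D u.

Let Dgt0 (x : R) : D x -> 0 < x.
Proof. by rewrite /= in_itv/= andbT; exact: lt_trans. Qed.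

Let mabsu : measurable_fun D (fun s => `|u s|).
Proof. exact: measurableT_comp. Qed.

(** The first coordinate is [t], the second is [s]. The parameter [m] will be the Cesaro kernel or
    [min(1, s/t)], so both double integrals share their measurability and sign arguments. *)
Let double_integrand (m : R -> R -> R) (z : R * R) : \bar R :=
  (k z.1 * (m z.2 z.1 * `|u z.2|))%:E.

Let measurable_double_integrand (m : R -> R -> R) :
  measurable_fun (D `*` D) (fun z => m z.2 z.1) ->
  measurable_fun (D `*` D) (double_integrand m).
Proof.
move=> mm; apply/measurable_EFinP; apply: measurable_funM.
  by apply: measurable_fun_setX_fst => //; exact: (measurable_inv_density hg).
apply: measurable_funM => //.
by apply: (@measurable_fun_setX_snd _ _ _ _ _ _ _ _ (fun s => `|u s|)).
Qed.

Let minfun (s t : R) := Num.min 1 (s / t).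

Let minfun_ge0 s t : D s -> D t -> 0 <= minfun s t.
Proof.
by move=> /Dgt0 s0 /Dgt0 t0; rewrite /minfun le_min ler01 divr_ge0 ?ltW.
Qed.

Let mquot : measurable_fun (D `*` D) (fun z => z.2 / z.1).
Proof.
apply: measurable_funM; first by apply: measurable_funS measurable_snd.
by apply: measurable_fun_setX_fst => //; exact: measurable_inv_gt1.
Qed.

Let mminfun : measurable_fun (D `*` D) (fun z => minfun z.2 z.1).
Proof. by apply: measurable_minr => //; exact: measurable_cst. Qed.

Let mkernel : measurable_fun (D `*` D) (fun z => cesaro_kernel z.2 z.1).
Proof.
rewrite /cesaro_kernel; apply: measurable_funM; last first.
  by apply: measurable_fun_setX_fst => //; exact: measurable_inv_gt1.
apply: measurable_funM; first by apply: measurable_funS measurable_snd.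
apply: measurable_funB => //; apply: measurableT_comp => //.
apply: measurableT_comp => //.
apply: measurable_funM; first by apply: measurable_funS measurable_fst.
by apply: measurable_fun_setX_snd => //; exact: measurable_inv_gt1.
Qed.

Let double_integrand_ge0 m : (forall s t, D s -> D t -> 0 <= m s t) ->
  forall t s, D t -> D s -> (0 <= double_integrand m (t, s))%E.
Proof.
by move=> m0 t s Dt Ds; rewrite lee_fin mulr_ge0 ?inv_density_ge0// mulr_ge0// m0.
Qed.

Lemma measurable_cesaro_weight : measurable_fun D (cesaro_weight mu).
Proof.
pose f (z : R * R) : \bar R := (k z.1 * minfun z.2 z.1)%:E.
apply: (@measurable_fun_integral_setX2 _ _ _ _ R leb D D f) => //.
  apply/measurable_EFinP; apply: measurable_funM => //.
  by apply: measurable_fun_setX_fst => //; exact: (measurable_inv_density hg).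
by move=> t s Dt Ds; rewrite lee_fin mulr_ge0 ?inv_density_ge0 ?minfun_ge0.
Qed.

Let weighted_normE : (\int[leb \x leb]_(z in D `*` D) double_integrand minfun z =
  \int[leb]_(s in D) (cesaro_weight mu s * `|u s|%:E))%E.
Proof.
rewrite integral_setX21//; last 2 first.
- exact: measurable_double_integrand.
- exact/double_integrand_ge0/minfun_ge0.
apply: eq_integral => s; rewrite inE => Ds.
rewrite /double_integrand/=; under eq_integral do rewrite mulrA EFinM.
rewrite ge0_integralZr//.
  apply/measurable_EFinP; apply: measurable_funM.
    exact: (measurable_inv_density hg).
  apply: measurable_minr => //; apply: measurable_funM => //.
  exact: measurable_inv_gt1.
by move=> t Dt; rewrite lee_fin mulr_ge0 ?inv_density_ge0 ?minfun_ge0.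
Qed.

Let kernel_ge0 s t : D s -> D t -> 0 <= cesaro_kernel s t.
Proof. by move=> /Dgt0 s0 /Dgt0 t0; exact: cesaro_kernel_ge0. Qed.

(** Here [s] is integrated first, which produces the norm of [C_t(A) u]; in [weighted_normE] it is
    [t], which produces the weight. *)
Let cesaro_conditionE :
  (\int[leb \x leb]_(z in D `*` D) double_integrand (@cesaro_kernel R) z =
   \int[leb]_(t in D)
     ((`|derive1 g t^-1|)%:E * L1norm (cesaro_mean t u) * (t ^- 2)%:E))%E.
Proof.
rewrite integral_setX12//; last 2 first.
- exact: measurable_double_integrand.
- exact/double_integrand_ge0/kernel_ge0.
apply: eq_integral => t; rewrite inE => Dt; have t0 := Dgt0 Dt.
rewrite muleAC -EFinM (derive1_stieltjes hg) ?invr_gt0// normrN.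
rewrite ger0_norm ?stieltjes_slope_ge0// -exprVn -/(k t).
rewrite /double_integrand/=; under eq_integral do rewrite EFinM.
rewrite ge0_integralZl_EFin//; last 3 first.
- by move=> s Ds; rewrite lee_fin mulr_ge0// kernel_ge0.
- apply/measurable_EFinP; apply: measurable_funM => //.
  apply: measurable_funM => //; apply: measurable_funM => //.
  apply: measurable_funB => //; apply: measurableT_comp => //.
  apply: measurableT_comp => //.
  by apply: measurable_funM => //; exact: measurable_inv_gt1.
- exact: inv_density_ge0.
congr (_ * _)%E; apply: eq_integral => s; rewrite inE => Ds.
have s0 := Dgt0 Ds.
by rewrite cesaro_meanE// normrM ger0_norm// cesaro_kernel_ge0.
Qed.

(** Both sides are double integrals over the same square, whose kernels are compared pointwise. The
    bounds hold in the extended reals, so finiteness passes either way. *)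
Lemma cesaro_condition_bounds :
  let I := (\int[leb]_(t in D)
    ((`|derive1 g t^-1|)%:E * L1norm (cesaro_mean t u) * (t ^- 2)%:E))%E in
  let J := (\int[leb]_(s in D) (cesaro_weight mu s * `|u s|%:E))%E in
  (I <= J)%E /\ (J <= 2%:E * I)%E.
Proof.
rewrite /= -cesaro_conditionE -weighted_normE.
have mD2 : measurable (D `*` D) by exact: measurableX.
split.
  apply: ge0_le_integral => //.
  - by move=> [t s] [Dt Ds]; apply: double_integrand_ge0.
  - exact: measurable_double_integrand.
  - exact: measurable_double_integrand.
  move=> [t s] [/= Dt Ds]; rewrite /double_integrand lee_fin /=.
  rewrite ler_wpM2l ?inv_density_ge0//.
  rewrite ler_wpM2r//.
  by have /andP[] := cesaro_kernel_bounds (Dgt0 Ds) (Dgt0 Dt).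
rewrite -ge0_integralZl_EFin//; last 2 first.
- by move=> [t s] [Dt Ds]; apply: double_integrand_ge0.
- exact: measurable_double_integrand.
apply: ge0_le_integral => //.
- by move=> [t s] [Dt Ds]; apply: double_integrand_ge0.
- exact: measurable_double_integrand.
- by apply: measurable_funeM; exact: measurable_double_integrand.
move=> [t s] [/= Dt Ds]; rewrite /double_integrand -EFinM lee_fin /=.
rewrite [leRHS]mulrCA ler_wpM2l ?inv_density_ge0//.
rewrite mulrA ler_wpM2r//.
by have /andP[] := cesaro_kernel_bounds (Dgt0 Ds) (Dgt0 Dt).
Qed.

End cesaro_condition.

(** * Monotonicity of the weight and its relation to the mean of [g] *)

Section mean_weight.
Context {R : realType} (mu : {measure set (measurableTypeR R) -> \bar R}).
Variable g : R -> R.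
Hypothesis hg : stieltjes_repr mu g.

Local Notation leb := (@lebesgue_measure R).
Local Notation D := (`]1%R, +oo[%classic : set R).
Local Notation k := (inv_density mu).
Local Notation N := (cesaro_weight mu).

Lemma measurable_stieltjes (a : R) : measurable_fun (`]0%R, a[ : set R) g.
Proof.
apply: open_continuous_measurable_fun; first exact: interval_open.
by move=> x; rewrite inE/= in_itv/= => /andP[x0 _]; exact: (continuous_stieltjes hg).
Qed.

Lemma measurable_stieltjes_inv : measurable_fun D (fun s => g s^-1).
Proof.
apply: open_continuous_measurable_fun; first exact: interval_open.
move=> x; rewrite inE/= in_itv/= andbT => x1; have x0 : 0 < x by exact: lt_trans x1.
apply: differentiable_continuous; apply/derivable1_diffP.
by case: (is_derive_stieltjes_inv hg x0).
Qed.

Lemma cesaro_weight_ge0 (s : R) : 0 < s -> (0 <= N s)%E.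
Proof.
move=> s0; apply: integral_ge0 => t; rewrite /= in_itv/= andbT => t1.
rewrite lee_fin mulr_ge0 ?inv_density_ge0// le_min ler01 divr_ge0 ?ltW//.
exact: lt_trans t1.
Qed.

Lemma le_cesaro_weight (s1 s2 : R) : 0 < s1 -> s1 <= s2 -> (N s1 <= N s2)%E.
Proof.
move=> s10 s12.
have mN (s : R) : measurable_fun D (fun t => (k t * Num.min 1 (s / t))%:E).
  apply/measurable_EFinP; apply: measurable_funM.
    exact: (measurable_inv_density hg).
  apply: measurable_minr => //; apply: measurable_funM => //.
  exact: measurable_inv_gt1.
have Dgt0 (t : R) : D t -> 0 < t by rewrite /= in_itv/= andbT; exact: lt_trans.
apply: ge0_le_integral => //.
- move=> t /Dgt0 t0.
  by rewrite lee_fin mulr_ge0 ?inv_density_ge0// le_min ler01 divr_ge0 ?ltW.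
- exact: mN.
- exact: mN.
- move=> t /Dgt0 t0; rewrite lee_fin ler_wpM2l ?inv_density_ge0//.
  by rewrite le_min !ge_min lexx/= ler_pM2r ?invr_gt0// s12 orbT.
Qed.

(** Add the constant [g 1] back to the formula for the weight. Infinite values are allowed, so
    integrability of [g] can be read off from finiteness of the weight. *)
Lemma stieltjes_meanE (t : R) : 0 < t <= 1 ->
  (\int[leb]_(x in `]0%R, t[) (g x)%:E = t%:E * (N t^-1 + (g 1)%:E))%E.
Proof.
move=> /andP[t0 t1].
have t'1 : 1 <= t^-1 by rewrite invf_ge1.
have g1 : 0 <= g 1 by exact: (stieltjes_ge0 hg).
rewrite (cesaro_weightE hg)// invrK.
have ge0 x : `]0%R, t[%classic x -> (0 <= (g x - g 1)%:E)%E.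
  rewrite /= in_itv/= => /andP[x0 xt]; rewrite lee_fin subr_ge0.
  by rewrite (le_stieltjes hg)// ltW// (lt_le_trans xt).
have -> : (\int[leb]_(x in `]0%R, t[) (g x)%:E =
    \int[leb]_(x in `]0%R, t[) (g x - g 1)%:E + (t * g 1)%:E)%E.
  under eq_integral do rewrite -(subrK (g 1) (g _)) EFinD.
  rewrite ge0_integralD//; last first.
    apply/measurable_EFinP; apply: measurable_funB => //.
    exact: measurable_stieltjes.
  congr (_ + _)%E; rewrite integral_cst//.
  rewrite [X in (_ * X)%E](lebesgue_measure_itv _)/= lte_fin t0 oppr0 adde0.
  by rewrite -EFinM mulrC.
rewrite ge0_muleDr ?mule_ge0 ?integral_ge0 ?lee_fin ?invr_ge0 ?(ltW t0)//.
by rewrite muleA -!EFinM divff ?gt_eqF// mul1e.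
Qed.

End mean_weight.

(** * Embedding of weighted spaces forces comparison of the weights *)

Local Notation leb := (@lebesgue_measure _).

(* Gliding hump: if [N <= C w] failed for every [C], a sum of normalised
   indicators of intervals [[s_n, 2 s_n]] on which [N / w] is large would have
   finite [w]-norm but infinite [N]-norm. *)
Lemma weight_comparison (R : realType) (w : R -> R) (N : R -> \bar R) :
  let D := `]1%R, +oo[%classic : set R in
  measurable_fun D w -> measurable_fun D N ->
  0 < w 1 ->
  (forall s1 s2, 1 <= s1 -> s1 <= s2 -> w s1 <= w s2) ->
  (forall s, 1 <= s -> w (2 * s) <= 2 * w s) ->
  (forall s, 1 <= s -> (0 <= N s)%E) ->
  (forall s1 s2, 1 <= s1 -> s1 <= s2 -> (N s1 <= N s2)%E) ->
  (forall u : R -> R, leb.-integrable D (EFin \o u) ->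
    (\int[leb]_(s in D) (w s * `|u s|)%:E < +oo)%E ->
    (\int[leb]_(s in D) (N s * `|u s|%:E) < +oo)%E) ->
  exists2 C : R, 0 < C & forall s, 1 < s -> (N s <= (C * w s)%:E)%E.
Proof.
move=> D mw mN w1 wnd w2 N0 Nnd domN.
apply: contrapT => /forall2NP noC.
(* The factor [2 ^ n.+1] will offset the summable normalisation of the humps, and [n.+1] will make
   their [N]-norms unbounded. *)
have /choice[S S_] (n : nat) : exists s : R, 1 < s /\
    ((n.+1%:R * (2 ^ n.+1)%:R * w s)%R%:E < N s)%E.
  have [|] := noC (n.+1%:R * (2 ^ n.+1)%:R).
    by rewrite mulr_gt0// ltr0n expn_gt0.
  move=> /existsNP[s /not_implyP[s1 /negP]]; rewrite -ltNge => H.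
  by exists s.
have S1 n : 1 < S n by have [] := S_ n.
have S0 n : 0 < S n by exact: lt_trans (S1 n).
have wS n s : S n <= s -> w 1 <= w s.
  by move=> Ss; rewrite wnd// (le_trans _ Ss)// ltW.
have wS0 n : 0 < w (S n) by rewrite (lt_le_trans w1)// (wS n).
(* As [J n] has length [S n], this makes the [n]-th hump have [w]-norm about [2 ^- n.+1]. *)
pose c n := (2 ^ n.+1)%:R^-1 / (S n * w (S n)).
have c0 n : 0 < c n by rewrite divr_gt0 ?mulr_gt0// invr_gt0 ltr0n expn_gt0.
pose J n : set R := `[S n, 2 * S n]%classic.
have JD n : J n `<=` D.
  by move=> s; rewrite /J /D /= !in_itv/= andbT => /andP[+ _]; exact: lt_le_trans.
have lebJ n : @lebesgue_measure R (J n) = (S n)%:E.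
  apply: etrans (lebesgue_measure_itv _) _; rewrite /= lte_fin.
  by rewrite ltr_pMl// ltr1n -EFinB mulr_natl mulr2n addrK.
pose U (s : R) : \bar R := (\sum_(0 <= n <oo) (c n * \1_(J n) s)%:E)%E.
have U0 s : (0 <= U s)%E.
  by apply: nneseries_ge0 => n _ _; rewrite lee_fin mulr_ge0// ltW.
have cU n s : ((c n * \1_(J n) s)%:E <= U s)%E.
  have H m : (0 <= (c m * \1_(J m) s)%:E)%E by rewrite lee_fin mulr_ge0// ltW.
  apply: le_trans (nneseries_lim_ge n.+1 _) => //.
  by rewrite big_nat_recr//= leeDr// sume_ge0.
(* Since [S n > 1] and [w (S n) >= w 1], each [c n] is at most [2 ^- n.+1 / w 1]: the series
   converges even where the intervals overlap. *)
have Ufin s : U s \is a fin_num.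
  rewrite ge0_fin_numE//; apply: (@le_lt_trans _ _ (w 1)^-1%:E); last exact: ltry.
  apply: le_trans (epsilon_trick0 xpredT _); last by rewrite invr_ge0 ltW.
  apply: lee_nneseries => n _; first by rewrite lee_fin mulr_ge0// ltW.
  rewrite lee_fin (le_trans (_ : _ <= c n))//.
    by rewrite ler_piMr ?(ltW (c0 n))// indicE; case: (_ \in _).
  rewrite mulrC /c ler_wpM2l ?invr_ge0// lef_pV2 ?posrE ?mulr_gt0//.
  rewrite (le_trans (wS n (S n) _))// ler_peMl// ltW//.
pose u s := fine (U s).
have uE s : (u s)%:E = U s by rewrite /u fineK.
have mJ n : measurable_fun D (fun s => (c n * \1_(J n) s)%:E).
  apply/measurable_EFinP; apply: measurable_funM => //.
  apply: measurable_indic; exact: measurable_itv.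
have mU : measurable_fun D U.
  apply: ge0_emeasurable_sum => // n s _ _.
  by rewrite lee_fin mulr_ge0// ltW.
have mu_ : measurable_fun D u.
  by apply/measurable_EFinP; rewrite (_ : EFin \o u = U)//; apply/funext.
have uabs s : `|u s| = u s by rewrite ger0_norm// -lee_fin uE.
have mD : measurable D by exact: measurable_itv.
have intJ n (a : R) : 0 <= a ->
    (\int[leb]_(s in D) (a * \1_(J n) s)%:E = (a * S n)%:E)%E.
  move=> a0; under eq_integral do rewrite EFinM.
  rewrite ge0_integralZl_EFin//; last first.
    by apply/measurable_EFinP; apply: measurable_indic; exact: measurable_itv.
  rewrite integral_indic//; last exact: measurable_itv.
  by rewrite (setIidl (JD n)) EFinM; congr (_ * _)%E; exact: lebJ.
have Dge1 s : D s -> 1 <= s by rewrite /D/= in_itv/= andbT => /ltW.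
have wge0 s : D s -> 0 <= w s.
  by move=> /Dge1 s1; rewrite (le_trans (ltW w1))// wnd.
(* On [J n], monotonicity and doubling give [w s <= w (2 S n) <= 2 w (S n)], so the [n]-th term is
   at most [2 / 2 ^ n.+1] and the sum at most 2. *)
have wfin : (\int[leb]_(s in D) (w s * `|u s|)%:E < +oo)%E.
  apply: (@le_lt_trans _ _ (2 : R)%:E); last exact: ltry.
  rewrite (_ : integral _ _ _ = (\int[leb]_(s in D)
      \sum_(0 <= n <oo) ((w s)%:E * (c n * \1_(J n) s)%:E))%E); last first.
    apply: eq_integral => s; rewrite inE => Ds.
    rewrite nneseriesZl; last by move=> n _; rewrite lee_fin mulr_ge0// ltW.
    by rewrite uabs EFinM uE.
  rewrite integral_nneseries//; last 2 first.
  - by move=> n; apply: emeasurable_funM; [exact/measurable_EFinP|exact: mJ].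
  - by move=> n s Ds; rewrite -EFinM lee_fin mulr_ge0 ?wge0// mulr_ge0// ltW.
  apply: le_trans (epsilon_trick0 xpredT (ler0n _ 2)).
  apply: lee_nneseries => [n _ _|n _].
    apply: integral_ge0 => s Ds.
    by rewrite -EFinM lee_fin mulr_ge0 ?wge0// mulr_ge0// ltW.
  rewrite (_ : (2 / _)%R = 2 * w (S n) * c n * S n); last first.
    by rewrite /c; field; rewrite !gt_eqF// ltr0n expn_gt0.
  have a0 : 0 <= 2 * w (S n) * c n.
    by rewrite mulr_ge0 ?(ltW (c0 n))// mulr_ge0// ltW.
  rewrite -intJ//; apply: ge0_le_integral => //.
  - by move=> s Ds; rewrite -EFinM lee_fin mulr_ge0 ?wge0// mulr_ge0// ltW.
  - by apply: emeasurable_funM; [exact/measurable_EFinP|exact: mJ].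
  - apply/measurable_EFinP; apply: measurable_funM => //.
    by apply: measurable_indic; exact: measurable_itv.
  move=> s Ds; rewrite -EFinM lee_fin indicE.
  have [|_] := boolP (s \in J n); last by rewrite !mulr0.
  rewrite inE /J/= in_itv/= => /andP[Ss s2S]; rewrite !mulr1.
  rewrite ler_wpM2r ?(ltW (c0 n))// (le_trans _ (w2 _ (ltW (S1 n))))//.
  by rewrite wnd// (le_trans _ Ss)// ltW.
(* As [w >= w 1 > 0] on the domain, the weighted norm controls the [L_1] norm. *)
have uint : leb.-integrable D (EFin \o u).
  apply/integrableP; split; first exact/measurable_EFinP.
  apply: (@le_lt_trans _ _
      ((w 1)^-1%:E * \int[leb]_(s in D) (w s * `|u s|)%:E)%E); last first.
    by rewrite lte_mul_pinfty// lee_fin invr_ge0 ltW.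
  have mwu : measurable_fun D (fun s => (w s * `|u s|)%:E).
    apply/measurable_EFinP; apply: measurable_funM => //.
    exact: measurableT_comp.
  rewrite -ge0_integralZl_EFin//; last 2 first.
  - by move=> s Ds; rewrite lee_fin mulr_ge0// wge0.
  - by rewrite invr_ge0 ltW.
  apply: ge0_le_integral => //.
  - by apply: measurableT_comp => //; exact/measurable_EFinP.
  - exact: measurable_funeM.
  move=> s /Dge1 s1; rewrite /= lee_fin mulrA ler_peMl//.
  by rewrite ler_pdivlMl// mulr1 wnd.
(* Keep only the [n]-th hump: there [N] is at least [N (S n)], hence at least [a], and
   [a * c n * S n = n.+1]. *)
have lb n : (n.+1%:R%:E <= \int[leb]_(s in D) (N s * `|u s|%:E))%E.
  pose a := n.+1%:R * (2 ^ n.+1)%:R * w (S n).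
  have a0 : 0 <= a by rewrite mulr_ge0// ltW.
  rewrite (_ : n.+1%:R = a * c n * S n); last first.
    by rewrite /a /c; field; rewrite !gt_eqF// ltr0n expn_gt0.
  have ac0 : 0 <= a * c n by rewrite mulr_ge0// ltW.
  rewrite -intJ//; apply: ge0_le_integral => //.
  - by move=> s Ds; rewrite lee_fin mulr_ge0.
  - apply/measurable_EFinP; apply: measurable_funM => //.
    by apply: measurable_indic; exact: measurable_itv.
  - apply: emeasurable_funM => //; apply/measurable_EFinP.
    exact: measurableT_comp.
  move=> s Ds; rewrite -mulrA EFinM.
  have [sJ|sJ] := boolP (s \in J n); last first.
    by rewrite indicE (negbTE sJ) !mulr0 mule0 mule_ge0// N0// Dge1.
  have cJ0 : 0 <= c n * \1_(J n) s by rewrite mulr_ge0// ltW.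
  apply: lee_pmul; rewrite ?lee_fin//.
    apply: (le_trans (ltW (S_ n).2)); apply: Nnd; first exact/ltW.
    by move: sJ; rewrite inE /J/= in_itv/= => /andP[].
  by rewrite uabs -lee_fin uE.
have := domN u uint wfin; set I := (X in (X < _)%E) => Ifin.
have If : I \is a fin_num.
  by rewrite ge0_fin_numE//; apply: le_trans (lb 0%N); rewrite lee_fin.
have := lb (Num.truncn (fine I)); rewrite -/I -(fineK If) lee_fin leNgt.
by rewrite truncnS_gt.
Qed.

(** * The equivalence *)

Theorem theorem4p1 (R : realType)
    (mu : {measure set (measurableTypeR R) -> \bar R}) (g : R -> R)
    (hg : stieltjes_repr mu g)
    (hg0 : g x @[x --> 0^'+] --> +oo) :
  (forall u : R -> R, dom_gA g u ->
     (\int[@lebesgue_measure R]_(t in `]1%R, +oo[)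
        ((`|derive1 g t^-1|)%:E * L1norm (cesaro_mean t u) * (t ^- 2)%:E) < +oo)%E)
  <->
  ((@lebesgue_measure R).-integrable `]0%R, 1%R[ (EFin \o g) /\
   exists2 c : R, 0 < c &
     forall t : R, 0 < t < 1 ->
       t^-1 * (\int[@lebesgue_measure R]_(tau in `]0%R, t[) g tau)%R
         <= c * g t).
Proof.
(* If [g 1 = 0], dilation gives [g x <= g 1 / x = 0] for [0 < x <= 1], against [g(0+) = oo]. *)
have g1 : 0 < g 1.
  rewrite lt0r (stieltjes_ge0 hg)// andbT; apply/eqP => g10.
  have /cvgryPgt/(_ 0) : g x @[x --> 0^'+] --> +oo := hg0.
  have x1 : \forall x \near (0:R)^'+, 0 < x <= 1.
    near=> x; apply/andP; split; near: x; [exact: nbhs_right_gt|].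
    exact: nbhs_right_le.
  move=> gx; have [x [x01 gx0]] := filter_ex (filterI x1 gx).
  have := stieltjes_dilation hg x01 (@ltr01 R).
  by rewrite mulr1 g10 mulr0 leNgt gx0.
have g_ge0 x : 0 < x -> 0 <= g x by exact: (stieltjes_ge0 hg).
have meas_u u : inL1 u -> measurable_fun (`]1%R, +oo[ : set R) u.
  by move=> iu; apply/measurable_EFinP; exact: (measurable_int _ iu).
split=> [cond|[gint [c c0 gmean]] u [iu ufin]].
- have [C C0 NC] : exists2 C : R, 0 < C &
      forall s, 1 < s -> (cesaro_weight mu s <= (C * g s^-1)%:E)%E.
    apply: (@weight_comparison R (fun s => g s^-1) (cesaro_weight mu)).
    + exact: (measurable_stieltjes_inv hg).
    + exact: (measurable_cesaro_weight hg).
    + by rewrite invr1.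
    + move=> s1 s2 s11 s12; have s10 : 0 < s1 by exact: lt_le_trans s11.
      have s20 : 0 < s2 by exact: lt_le_trans s12.
      by rewrite (le_stieltjes hg) ?invr_gt0// lef_pV2.
    + move=> s s1; have s0 : 0 < s by exact: lt_le_trans s1.
      have h01 : 0 < (2^-1 : R) <= 1 by apply/andP; split; lra.
      have s'0 : 0 < s^-1 by rewrite invr_gt0.
      by have := stieltjes_dilation hg h01 s'0; rewrite invrK invfM.
    + by move=> s s1; apply: cesaro_weight_ge0; exact: lt_le_trans s1.
    + by move=> s1 s2 s11; apply: (le_cesaro_weight hg); exact: lt_le_trans s11.
    + move=> u iu ufin; have [_] := cesaro_condition_bounds hg (meas_u u iu).
      move=> /le_lt_trans; apply; rewrite lte_mul_pinfty//.
      exact: cond.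
  have gE t (t01 : 0 < t <= 1) := stieltjes_meanE hg t01.
  have mg a := measurable_stieltjes hg a.
  have gfin t : 0 < t <= 1 -> (cesaro_weight mu t^-1 < +oo)%E ->
      (\int[@lebesgue_measure R]_(x in `]0%R, t[) (g x)%:E < +oo)%E.
    move=> /[dup] t01 /andP[t0 t1] Nfin.
    by rewrite gE//; apply: lte_mul_pinfty => //;
      [rewrite lee_fin ltW|rewrite lte_add_pinfty// ltry].
  split.
    apply/integrableP; split; first by apply/measurable_EFinP; exact: mg.
    rewrite (_ : integral _ _ _ =
        (\int[@lebesgue_measure R]_(x in `]0%R, 1%R[) (g x)%:E)%E).
      apply: gfin; first by rewrite ltr01 lexx.
      (* The bound [NC] is available for [s > 1] only, so finiteness at 1 is taken from the larger
         value at 2. *)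
      have N12 := le_cesaro_weight hg (@ltr01 R) (ler1n R 2).
      rewrite invr1; apply: (le_lt_trans N12).
      by apply: (le_lt_trans (NC _ _)); rewrite ?ltr1n// ltry.
    apply: eq_integral => x; rewrite inE/= in_itv/= => /andP[x0 _].
    by rewrite ger0_norm ?g_ge0.
  (* The mean of [g] over []0, t[] is [N(1/t) + g 1], and [g 1 <= g t]; the extra 1 absorbs this
     last term. *)
  exists (C + 1) => [|t /andP[t0 t1]]; first by rewrite addr_gt0.
  have t01 : 0 < t <= 1 by rewrite t0 ltW.
  have Nt : (cesaro_weight mu t^-1 <= (C * g t)%:E)%E.
    by have := NC t^-1; rewrite invrK; apply; rewrite invf_gt1.
  have Nfin : cesaro_weight mu t^-1 \is a fin_num.
    rewrite ge0_fin_numE; first by apply: le_lt_trans Nt (ltry _).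
    by apply: cesaro_weight_ge0; rewrite invr_gt0.
  rewrite /Rintegral gE// -(fineK Nfin) -EFinD -EFinM/= mulKf ?gt_eqF//.
  rewrite mulrDl mul1r lerD//; first by rewrite -lee_fin fineK.
  by rewrite (le_stieltjes hg)// ltW.
- have N_le s : 1 < s -> (cesaro_weight mu s <= (c * g s^-1)%:E)%E.
    move=> s1; have s0 : 0 < s by exact: lt_trans s1.
    have s'01 : 0 < s^-1 < 1 by rewrite invr_gt0 s0 invf_lt1.
    have s'01' : 0 < s^-1 <= 1 by have /andP[-> /ltW ->] := s'01.
    have := gmean _ s'01; rewrite /Rintegral.
    (* A divergent integral would have real value 0 and make the mean bound say nothing;
       integrability of [g] ensures that the real integral is the true one. *)
    have gi : (\int[@lebesgue_measure R]_(x in `]0%R, s^-1%R[) (g x)%:E)%E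
        \is a fin_num.
      apply: integrable_fin_num => //; apply: integrableS gint => //.
      by apply: subset_itvl; rewrite bnd_simp; have /andP[_] := s'01'.
    rewrite -lee_fin EFinM fineK// (stieltjes_meanE hg s'01') !invrK.
    (* The mean is now [N s + g 1], so dropping [g 1 >= 0] leaves the bound on the weight. *)
    rewrite muleA -EFinM divff ?gt_eqF// mul1e; apply: le_trans.
    by rewrite leeDl// lee_fin ltW.
  have [+ _] := cesaro_condition_bounds hg (meas_u u iu).
  move=> /le_lt_trans; apply.
  apply: (@le_lt_trans _ _ (c%:E * \int[@lebesgue_measure R]_(s in `]1%R, +oo[)
      (g s^-1 * `|u s|)%:E)%E); last first.
    by rewrite lte_mul_pinfty// lee_fin ltW.
  have mgu : measurable_fun (`]1%R, +oo[ : set R) (fun s => (g s^-1 * `|u s|)%:E).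
    apply/measurable_EFinP; apply: measurable_funM.
      exact: (measurable_stieltjes_inv hg).
    by apply: measurableT_comp => //; exact: meas_u.
  have Dgt0 (s : R) : `]1%R, +oo[%classic s -> 0 < s.
    by rewrite /= in_itv/= andbT; exact: lt_trans.
  rewrite -ge0_integralZl_EFin//; last 2 first.
  - by move=> s /Dgt0 s0; rewrite lee_fin mulr_ge0// g_ge0 ?invr_gt0.
  - exact: ltW.
  apply: ge0_le_integral => //.
  - by move=> s /Dgt0 s0; rewrite mule_ge0// cesaro_weight_ge0.
  - apply: emeasurable_funM; first exact: (measurable_cesaro_weight hg).
    by apply/measurable_EFinP; apply: measurableT_comp => //; exact: meas_u.
  - exact: measurable_funeM.
  - move=> s; rewrite /= in_itv/= andbT => s1.
    by rewrite EFinM muleA -(EFinM c); apply: lee_wpmul2r => //; exact: N_le.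
Unshelve. all: by end_near.
Qed.
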